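(* Let $f:\mathbb{C}_+\to\mathbb{C}_+$ be a function. The function $$\mathcal{C}_{\mathbb{D},1}:\mathbb{D}\to[0,2\pi),\qquad z\mapsto \arg\Big(T_{\mathbb{D}}\big(\mathrm{Re}\big(f(T_{\mathbb{D}}^{-1}(z))\big)\big)\Big)$$ assigns a unique color to the preimage of each tractrix line. That is, writing $V_c=\{w\in\mathbb{C}_+ : \mathrm{Re}(w)=c\}$ for $c\in\mathbb{R}$ and $P_c=\{z\in\mathbb{D} : f(T_{\mathbb{D}}^{-1}(z))\in V_c\}$: for every $c\in\mathbb{R}$ the function $\mathcal{C}_{\mathbb{D},1}$ is constant on $P_c$, and if $c\neq c'$, $z\in P_c$ and $z'\in P_{c'}$, then $\mathcal{C}_{\mathbb{D},1}(z)\neq \mathcal{C}_{\mathbb{D},1}(z')$.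
   Context: $\mathbb{C}_+=\{w\in\mathbb{C}:\mathrm{Im}(w)>0\}$ is the upper half-plane model of hyperbolic space and $\mathbb{D}=\{z\in\mathbb{C}:|z|<1\}$ is the Poincaré disc. The map $T_{\mathbb{D}}$ is inversion in the circle $K$ of radius $\sqrt{2}$ centered at $-i$, followed by complex conjugation; explicitly $T_{\mathbb{D}}(w)=\frac{iw+1}{w+i}$. It maps $\mathbb{C}_+$ bijectively and conformally onto $\mathbb{D}$, with inverse $T_{\mathbb{D}}^{-1}:\mathbb{D}\to\mathbb{C}_+$ (conjugation followed by inversion in $K$). The same formula is used to apply $T_{\mathbb{D}}$ to real numbers, which it sends to the unit circle. $\arg$ denotes the argument of a nonzero complex number, taken in $[0,2\pi)$; its values are regarded as colors on the color wheel. The tractrix lines (the tractrix generators of the pseudosphere) are represented in $\mathbb{C}_+$ by the vertical half-lines $V_c$, $c\in\mathbb{R}$. The preimage of a tractrix line is the set of points $z\in\mathbb{D}$ such that $f(T_{\mathbb{D}}^{-1}(z))$ lies on the corresponding vertical half-line. No regularity is assumed of $f$. *)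

(* Defs.v *)
From Stdlib Require Import Reals Lra Psatz ClassicalEpsilon.
From Coquelicot Require Import Coquelicot.
Local Open Scope R_scope.

Definition half_plane : Type := {w : C | 0 < Im w}.
Definition unit_disc : Type := {z : C | Cmod z < 1}.

(** [argument_of z t]: [t] is the representative in [[0, 2 PI)] of the argument
    of [z], that is [z = |z| e^(i t)]. *)
Definition argument_of (z : C) (t : R) : Prop :=
  0 <= t < 2 * PI /\ z = (RtoC (Cmod z) * (cos t, sin t))%C.

(** Meaningful only for [z <> 0], where [argument_of z] has exactly one solution
    ([argument_of_exists_unique]); the value at [0] is unspecified. *)
Definition Carg (z : C) : R := epsilon (inhabits 0) (argument_of z).

(** The value at the center [a] is a dummy. *)
Definition circle_inversion (a : C) (r : R) (w : C) : C :=
  (a + RtoC (r ^ 2) / Cconj (w - a))%C.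

(** Defined on all of [C] so that it also applies to real numbers; the value at
    the pole [- Ci] is a dummy. *)
Definition T_D (w : C) : C := ((Ci * w + 1) / (w + Ci))%C.

Definition T_D_inv_val (z : C) : C := circle_inversion (- Ci)%C (sqrt 2) (Cconj z).

Lemma C_ext (z w : C) : Re z = Re w -> Im z = Im w -> z = w.
Proof. destruct z, w; simpl; intros -> ->; reflexivity. Qed.

Lemma Cmod_lt_1 (z : C) : Cmod z < 1 <-> Re z ^ 2 + Im z ^ 2 < 1.
Proof.
rewrite <- Cmod2_alt; pose proof (Cmod_ge_0 z); split; nra.
Qed.

Lemma disc_neq_Ci (z : C) : Cmod z < 1 -> (z - Ci)%C <> 0%C.
Proof.
intros Hz E. assert (z = Ci) as -> by (apply Ceq_minus; exact E).
rewrite Cmod_Ci in Hz; lra.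
Qed.

Lemma half_plane_neq_mCi (w : C) : 0 < Im w -> (w + Ci)%C <> 0%C.
Proof.
intros Hw E. apply (f_equal Im) in E. destruct w as [x y]; simpl in *; lra.
Qed.

Lemma T_D_inv_valE (z : C) : T_D_inv_val z = (- Ci + 2 / (z - Ci))%C.
Proof.
unfold T_D_inv_val, circle_inversion.
rewrite pow2_sqrt by lra.
replace (Cconj (Cconj z - - Ci)) with (z - Ci)%C; [reflexivity|].
apply C_ext; destruct z; simpl; ring.
Qed.

Lemma T_D_inv_subproof (z : unit_disc) : 0 < Im (T_D_inv_val (proj1_sig z)).
Proof.
destruct z as [z Hz]; cbn [proj1_sig]. pose proof (disc_neq_Ci z Hz) as Hn.
apply Cmod_lt_1 in Hz. rewrite T_D_inv_valE.
destruct z as [x y]; simpl in *.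
assert (Hd : 0 < x ^ 2 + (1 - y) ^ 2) by nra.
match goal with |- 0 < ?e =>
  replace e with ((1 - x ^ 2 - y ^ 2) / (x ^ 2 + (1 - y) ^ 2)) end.
- apply Rdiv_lt_0_compat; nra.
- field; repeat split; nra.
Qed.

(** The inverse of [T_D : half_plane -> unit_disc] ([T_D_invK], [T_DK]). *)
Definition T_D_inv (z : unit_disc) : half_plane :=
  exist _ (T_D_inv_val (proj1_sig z)) (T_D_inv_subproof z).

Definition V (c : R) (w : half_plane) : Prop := Re (proj1_sig w) = c.

Definition P (f : half_plane -> half_plane) (c : R) (z : unit_disc) : Prop :=
  V c (f (T_D_inv z)).

Definition color (f : half_plane -> half_plane) (z : unit_disc) : R :=
  Carg (T_D (RtoC (Re (proj1_sig (f (T_D_inv z)))))).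

Lemma T_D_circle_inversion (w : C) : (w + Ci)%C <> 0%C ->
  T_D w = Cconj (circle_inversion (- Ci)%C (sqrt 2) w).
Proof.
intros Hw. unfold T_D, circle_inversion. rewrite pow2_sqrt by lra.
replace (w - - Ci)%C with (w + Ci)%C by ring.
rewrite Cplus_conj, Cdiv_conj, Cconj_conj.
- replace (Cconj (- Ci)) with Ci by (apply C_ext; simpl; ring).
  replace (Cconj (RtoC 2)) with (RtoC 2) by (apply C_ext; simpl; ring).
  transitivity (((Ci * Ci + 2) + Ci * w) / (w + Ci))%C.
  + replace (Ci * Ci + 2)%C with (RtoC 1); [f_equal; ring|].
    apply C_ext; simpl; ring.
  + field; exact Hw.
- intros E; apply Hw. rewrite <- (Cconj_conj (w + Ci)%C), E.
  apply C_ext; simpl; ring.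
Qed.

Lemma T_D_disc (w : half_plane) : Cmod (T_D (proj1_sig w)) < 1.
Proof.
destruct w as [w Hw]; cbn [proj1_sig]. unfold T_D.
pose proof (half_plane_neq_mCi w Hw) as Hn.
rewrite Cmod_div by exact Hn.
pose proof (proj1 (Cmod_gt_0 _) Hn) as Hp.
apply Rmult_lt_reg_r with (1 := Hp).
unfold Rdiv; rewrite Rmult_assoc, Rinv_l, Rmult_1_r, Rmult_1_l by lra.
apply Rsqr_incrst_0; [|apply Cmod_ge_0|lra].
rewrite !Rsqr_pow2, !Cmod2_alt. destruct w as [x y]; simpl in *; nra.
Qed.

Lemma Cmod_T_D_real (x : R) : Cmod (T_D (RtoC x)) = 1.
Proof.
unfold T_D. rewrite Cmod_div.
- replace (Cmod (x + Ci)) with (Cmod (Ci * x + 1)).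
  + apply Rinv_r, Rgt_not_eq, Cmod_gt_0.
    intros E; apply (f_equal Re) in E; simpl in E; lra.
  + unfold Cmod; f_equal; simpl; ring.
- intros E; apply (f_equal Im) in E; simpl in E; lra.
Qed.

Lemma T_D_invK (z : unit_disc) : T_D (proj1_sig (T_D_inv z)) = proj1_sig z.
Proof.
destruct z as [z Hz]; cbn [proj1_sig T_D_inv]. pose proof (disc_neq_Ci z Hz) as Hn.
rewrite T_D_inv_valE; unfold T_D.
transitivity (((- (Ci * Ci) + 1) * (z - Ci) + 2 * Ci) / 2)%C.
- field; split; auto.
  replace (- Ci * (z - Ci) + 2 + Ci * (z - Ci))%C with (RtoC 2) by ring.
  intros E; apply (f_equal Re) in E; simpl in E; lra.
- apply C_ext; destruct z; simpl; field.
Qed.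

Lemma T_DK (w : half_plane) :
  T_D_inv_val (T_D (proj1_sig w)) = proj1_sig w.
Proof.
destruct w as [w Hw]; cbn [proj1_sig]. pose proof (half_plane_neq_mCi w Hw) as Hn.
rewrite T_D_inv_valE; unfold T_D.
replace ((Ci * w + 1) / (w + Ci) - Ci)%C with (2 / (w + Ci))%C.
- field; exact Hn.
- transitivity ((1 - Ci * Ci) / (w + Ci))%C.
  + f_equal. apply C_ext; simpl; ring.
  + field; exact Hn.
Qed.

Lemma argument_of_exists_unique (z : C) : z <> 0%C -> exists! t, argument_of z t.
Proof.
intros Hz. pose proof (proj1 (Cmod_gt_0 z) Hz) as Hp.
pose proof PI_RGT_0 as Hpi.
pose proof (Cmod2_alt z) as E2.
destruct z as [x y]. set (r := Cmod (x, y)) in *. simpl Re in E2; simpl Im in E2.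
assert (Hx : -1 <= x / r <= 1).
{ assert (- r <= x <= r) by nra.
  split; apply Rmult_le_reg_r with (1 := Hp); unfold Rdiv;
    rewrite Rmult_assoc, Rinv_l by lra; lra. }
pose proof (acos_bound (x / r)) as Hb.
pose proof (cos_acos _ Hx) as Hc.
pose proof (sin2_cos2 (acos (x / r))) as Hs; rewrite !Rsqr_pow2, Hc in Hs.
assert (Hs' : (r * sin (acos (x / r))) ^ 2 = y ^ 2).
{ replace ((r * sin (acos (x / r))) ^ 2)
    with (r ^ 2 * (1 - (x / r) ^ 2)) by (rewrite <- Hs; ring).
  transitivity (r ^ 2 - x ^ 2); [field; lra | lra]. }
assert (Hsp : 0 <= sin (acos (x / r))) by (apply sin_ge_0; lra).
assert (Hxr : r * (x / r) = x) by (field; lra).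
assert (Hex : exists t, argument_of (x, y) t).
{ destruct (Rle_lt_dec 0 y) as [Hy|Hy].
  - exists (acos (x / r)); split; [lra|]. fold r.
    apply C_ext; simpl; rewrite ?Hc; [lra|].
    assert (r * sin (acos (x / r)) = y); [|lra].
    apply Rsqr_inj; [apply Rmult_le_pos; lra | lra | rewrite !Rsqr_pow2; exact Hs'].
  - exists (2 * PI - acos (x / r)); split.
    + assert (acos (x / r) <> 0).
      { intros E; rewrite E, sin_0 in Hs'; nra. }
      lra.
    + fold r. rewrite cos_minus, sin_minus, cos_2PI, sin_2PI, Hc.
      apply C_ext; simpl; [lra|].
      assert (r * sin (acos (x / r)) = - y); [|lra].
      apply Rsqr_inj; [apply Rmult_le_pos; lra | lra | rewrite !Rsqr_pow2; lra]. }
destruct Hex as [t Ht]; exists t; split; [exact Ht|].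
intros u [Hu Eu]; destruct Ht as [Ht Et]; fold r in Eu, Et.
pose proof (f_equal Re Eu) as Eu1; pose proof (f_equal Im Eu) as Eu2.
pose proof (f_equal Re Et) as Et1; pose proof (f_equal Im Et) as Et2.
simpl in Eu1, Eu2, Et1, Et2.
assert (C1 : cos t = cos u) by nra.
assert (S1 : sin t = sin u) by nra.
assert (Hk : cos (t - u) = 1).
{ rewrite cos_minus, C1, S1. pose proof (sin2_cos2 u); unfold Rsqr in *; lra. }
assert (Hh : sin ((t - u) / 2) = 0).
{ replace (t - u) with (2 * ((t - u) / 2)) in Hk by field.
  rewrite cos_2a_sin in Hk. nra. }
destruct (Rtotal_order t u) as [L|[L|L]]; [|exact L|].
- assert (0 < sin ((u - t) / 2)) by (apply sin_gt_0; lra).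
  replace ((u - t) / 2) with (- ((t - u) / 2)) in * by field.
  rewrite sin_neg in *; lra.
- assert (0 < sin ((t - u) / 2)) by (apply sin_gt_0; lra). lra.
Qed.

(* Main.v *)
Require Import Defs.
From Stdlib Require Import Reals Lra ClassicalEpsilon.
From Coquelicot Require Import Coquelicot.
Local Open Scope R_scope.

(** The color of [z] depends only on the real part [c] of [f (T_D_inv z)], which
    is the label of the tractrix line on which that point lies; hence colors are
    constant on [P f c]. It remains to see that [c |-> Carg (T_D c)] is injective
    on the real line: [T_D] is a Möbius map, hence injective, and it sends the
    real line into the unit circle ([Cmod_T_D_real]), where a point is determined
    by its argument. *)

Lemma Carg_spec (z : C) : z <> 0%C -> argument_of z (Carg z).
Proof.
intros Hz. unfold Carg. apply epsilon_spec.
destruct (argument_of_exists_unique z Hz) as [t [Ht _]]; exists t; exact Ht.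
Qed.

Lemma Carg_inj_on_circles (z w : C) :
  z <> 0%C -> Cmod z = Cmod w -> Carg z = Carg w -> z = w.
Proof.
intros Hz Hm Ha.
assert (Hw : w <> 0%C).
{ intros ->. apply Hz, Cmod_eq_0. rewrite Hm; apply Cmod_0. }
destruct (Carg_spec z Hz) as [_ ->], (Carg_spec w Hw) as [_ ->].
rewrite Hm, Ha; reflexivity.
Qed.

Lemma T_D_real_neq_0 (x : R) : T_D (RtoC x) <> 0%C.
Proof.
intros E. pose proof (Cmod_T_D_real x) as H. rewrite E, Cmod_0 in H; lra.
Qed.

(** Away from the pole, [T_D w = Ci + 2 / (w + Ci)], a translate of a multiple of
    an inverse. *)
Lemma T_D_inj (v w : C) :
  (v + Ci)%C <> 0%C -> (w + Ci)%C <> 0%C -> T_D v = T_D w -> v = w.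
Proof.
assert (HT : forall u, (u + Ci)%C <> 0%C -> ((T_D u - Ci) * (u + Ci) = 2)%C).
{ intros u Hu. unfold T_D.
  transitivity (1 - Ci * Ci)%C; [field; exact Hu|].
  apply C_ext; simpl; ring. }
intros Hv Hw E.
assert (Hn : (T_D w - Ci)%C <> 0%C).
{ intros E0. pose proof (HT w Hw) as H. rewrite E0, Cmult_0_l in H.
  apply (f_equal Re) in H; simpl in H; lra. }
pose proof (HT v Hv) as H. rewrite E, <- (HT w Hw) in H.
replace v with ((T_D w - Ci) * (v + Ci) / (T_D w - Ci) - Ci)%C
  by (field; exact Hn).
rewrite H; field; exact Hn.
Qed.

Lemma real_color_inj (a b : R) :
  Carg (T_D (RtoC a)) = Carg (T_D (RtoC b)) -> a = b.
Proof.
intros E.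
assert (Hp : forall x : R, (x + Ci)%C <> 0%C).
{ intros x H. apply (f_equal Im) in H; simpl in H; lra. }
apply RtoC_inj, T_D_inj; [apply Hp | apply Hp |].
apply Carg_inj_on_circles; [apply T_D_real_neq_0 | | exact E].
rewrite !Cmod_T_D_real; reflexivity.
Qed.

Theorem theorem1 (f : half_plane -> half_plane) :
  (forall z : unit_disc, 0 <= color f z < 2 * PI) /\
  (forall (c : R) (z z' : unit_disc), P f c z -> P f c z' -> color f z = color f z') /\
  (forall (c c' : R) (z z' : unit_disc),
     c <> c' -> P f c z -> P f c' z' -> color f z <> color f z').
Proof.
unfold color, P, V. split; [|split].
- intros z. exact (proj1 (Carg_spec _ (T_D_real_neq_0 _))).
- intros c z z' -> ->; reflexivity.
- intros c c' z z' Hc -> -> E. exact (Hc (real_color_inj _ _ E)).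
Qed.
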